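(* The randomized query complexity of deciding whether an $n$-vertex directed graph contains a king is $\Theta(n^2)$; that is, $\mathsf{R}(\textsf{EXIST-KING}_n)=\Theta(n^2)$ for general digraphs.
   Context: A king in a directed graph is a vertex $v$ such that for every other vertex $u\neq v$, either $v\to u$ is an edge or there is a vertex $w$ with $v\to w$ and $w\to u$ edges (i.e. every other vertex is reachable from $v$ by a directed path of length at most $2$). An $n$-vertex digraph on vertex set $\{0,1,\dots,n-1\}$ is given as a string in $\{0,1\}^{n^2}$, one bit per ordered pair indicating presence of that directed edge. $\textsf{EXIST-KING}_n$ is the problem of outputting $1$ if the input digraph contains a king and $0$ otherwise. In the query model an algorithm accesses the input only by querying bits (one query reveals one bit); a randomized decision tree is a probability distribution over deterministic decision trees, and $\mathsf{R}(f)$ is the minimum, over randomized decision trees that output a correct answer with probability at least $2/3$ on every input, of the maximum depth (number of queries) of any deterministic tree in its support. *)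

(* Defs.v *)
From HB Require Import structures.
From mathcomp Require Import all_boot all_order all_algebra finmap.
From mathcomp Require Import boolp reals.

Set Implicit Arguments.
Unset Strict Implicit.
Unset Printing Implicit Defensive.

Import Order.TTheory GRing.Theory Num.Theory.

Local Open Scope ring_scope.

Section DecisionTrees.
Variable I : Type.

(* [Query i t0 t1] reads bit [i] and goes on with [t0] if it is [false], with
   [t1] if it is [true]. *)
Inductive dtree : Type :=
  | Answer of bool
  | Query of I & dtree & dtree.

Fixpoint dtree_eval (t : dtree) (x : I -> bool) : bool :=
  match t with
  | Answer b => b
  | Query i t0 t1 => dtree_eval (if x i then t1 else t0) x
  end.

Fixpoint dtree_depth (t : dtree) : nat :=
  match t with
  | Answer _ => 0
  | Query _ t0 t1 => (maxn (dtree_depth t0) (dtree_depth t1)).+1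
  end.

HB.instance Definition _ := gen_eqMixin dtree.
HB.instance Definition _ := gen_choiceMixin dtree.

End DecisionTrees.

Section RandomizedQueryComplexity.
Variables (R : realType) (I : finType).

(* Finite support loses no generality: only finitely many trees over [I] have
   depth at most [d], so a distribution on trees whose depth is bounded on the
   support is finitely supported. *)
Definition is_rdtree (mu : {fsfun dtree I -> R with 0}) : Prop :=
  (forall t, 0 <= mu t) /\ \sum_(t <- finsupp mu) mu t = 1.

Definition rdtree_depth (mu : {fsfun dtree I -> R with 0}) : nat :=
  (\max_(t <- finsupp mu) dtree_depth t)%N.

Definition rdtree_computes (mu : {fsfun dtree I -> R with 0})
    (f : {ffun I -> bool} -> bool) : Prop :=
  forall x : {ffun I -> bool},
    2 / 3 <= \sum_(t <- finsupp mu | dtree_eval t x == f x) mu t.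

Definition rquery_depth (f : {ffun I -> bool} -> bool) : pred nat :=
  fun d => `[< exists mu, [/\ is_rdtree mu, rdtree_computes mu f
                            & rdtree_depth mu = d] >].

Fixpoint query_all (f : {ffun I -> bool} -> bool) (s : seq I)
    (y : {ffun I -> bool}) : dtree I :=
  if s is i :: s' then
    Query i (query_all f s' [ffun j => if j == i then false else y j])
            (query_all f s' [ffun j => if j == i then true else y j])
  else Answer I (f y).

Lemma query_allE f (s : seq I) (y x : {ffun I -> bool}) :
  (forall i, i \notin s -> y i = x i) -> dtree_eval (query_all f s y) x = f x.
Proof.
elim: s y => [|i s IHs] y yx /=; first by congr f; apply/ffunP => i; apply: yx.
case: ifP => xi; apply: IHs => j js; rewrite ffunE;
  case: eqVneq => [->|ji]; rewrite ?xi //; apply: yx; by rewrite inE negb_or ji.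
Qed.

Lemma rquery_depth_nonempty f : exists d, rquery_depth f d.
Proof.
pose t := query_all f (enum I) [ffun=> false].
pose mu : {fsfun dtree I -> R with 0} := [fsfun x in [fset t]%fset => 1 | 0].
have muE s : mu s = (s == t)%:R by rewrite fsfunE inE; case: eqP.
have supp : finsupp mu = [fset t]%fset.
  by apply/fsetP => s; rewrite mem_finsupp muE inE pnatr_eq0; case: (s == t).
exists (rdtree_depth mu); apply/asboolP; exists mu; split=> //.
  split=> [s|]; first by rewrite muE ler0n.
  by rewrite supp big_seq_fset1 muE eqxx.
move=> x; rewrite supp big_mkcond big_seq_fset1 query_allE ?eqxx ?muE ?eqxx.
  by rewrite ler_pdivrMr ?ltr0n // mul1r ler_nat.
by move=> i; rewrite mem_enum.
Qed.

Definition rquery_complexity (f : {ffun I -> bool} -> bool) : nat :=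
  ex_minn (rquery_depth_nonempty f).

End RandomizedQueryComplexity.

Definition is_king (T : finType) (e : rel T) (v : T) : bool :=
  [forall u, (u != v) ==> (e v u || [exists w, e v w && e w u])].

(* All n^2 ordered pairs are input bits, including the n diagonal ones (loops). *)
Definition exist_king (n : nat) (x : {ffun 'I_n * 'I_n -> bool}) : bool :=
  [exists v, is_king (fun a b => x (a, b)) v].

(* Main.v *)
(** An input [x] on which flipping any bit of a set [S] changes the value of
    [f] forces a bounded-error randomized tree to read each bit of [S] with
    probability at least 1/3 when run on [x], so its depth is at least
    [#|S| / 3].  For [exist_king] put [k = n / 3] and take vertices [v_i, w_i]
    ([i < k]) and [u_j] ([j < n - 2k]) with the edges [v_i -> w_j] for all
    [i, j], [w_i -> v_i], and [v_i -> u_j] for [j != i].  There is no king, but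
    [v_i] misses only [u_i], and each of the [k^2] absent edges [w_j -> u_i]
    ([i, j < k]) turns [v_i] into a king. *)
Require Import Defs.
From mathcomp Require Import all_boot all_order all_algebra finmap.
From mathcomp Require Import boolp classical_sets reals.
From mathcomp Require Import topology normedtype landau.
From mathcomp Require Import zify lra.

Import Order.TTheory GRing.Theory Num.Theory.
Import numFieldNormedType.Exports.
Local Open Scope classical_set_scope.
Local Open Scope ring_scope.

Section QueriedBits.
Context {I : eqType}.

Fixpoint queried (t : dtree I) (x : I -> bool) : seq I :=
  if t is Query i t0 t1 then i :: queried (if x i then t1 else t0) x
  else [::].

Lemma size_queried (t : dtree I) (x : I -> bool) :
  (size (queried t x) <= dtree_depth t)%N.
Proof.
elim: t => [//|i t0 IH0 t1 IH1] /=; rewrite ltnS leq_max.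
by case: (x i); rewrite ?IH0 ?IH1 ?orbT.
Qed.

Lemma dtree_eval_queried (t : dtree I) (x y : I -> bool) :
  {in queried t x, x =1 y} -> dtree_eval t x = dtree_eval t y.
Proof.
elim: t => [//|i t0 IH0 t1 IH1] /= xy.
have <- : x i = y i by apply: xy; rewrite mem_head.
have {}xy : {in queried (if x i then t1 else t0) x, x =1 y}.
  by move=> j jq; apply: xy; rewrite inE jq orbT.
by case: (x i) xy; [apply: IH1 | apply: IH0].
Qed.

End QueriedBits.

Section QueryComplexityBounds.
Context {R : realType} {I : finType}.
Implicit Types (f : {ffun I -> bool} -> bool) (x : {ffun I -> bool}).

Definition flip_bit x (i : I) : {ffun I -> bool} :=
  [ffun j => if j == i then ~~ x j else x j].

Lemma depth_query_all f (s : seq I) x :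
  dtree_depth (query_all f s x) = size s.
Proof. by elim: s x => [//|i s IHs] x /=; rewrite !IHs maxnn. Qed.

(** The point mass on the tree that reads every bit is always correct. *)
Lemma rquery_complexity_le_card f : (rquery_complexity R f <= #|I|)%N.
Proof.
rewrite /rquery_complexity; case: ex_minnP => m _; apply.
pose t := query_all f (enum I) [ffun=> false].
pose mu : {fsfun dtree I -> R with 0} := [fsfun x in [fset t]%fset => 1 | 0].
have muE s : mu s = (s == t)%:R by rewrite fsfunE inE; case: eqP.
have supp : finsupp mu = [fset t]%fset.
  by apply/fsetP => s; rewrite mem_finsupp muE inE pnatr_eq0; case: (s == t).
apply/asboolP; exists mu; split.
- split=> [s|]; first by rewrite muE ler0n.
  by rewrite supp big_seq_fset1 muE eqxx.
- move=> x; rewrite supp big_mkcond big_seq_fset1 query_allE.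
    by rewrite eqxx muE eqxx mulr1n; lra.
  by move=> i; rewrite mem_enum.
- by rewrite /rdtree_depth supp big_seq_fset1 depth_query_all cardE.
Qed.

(** A tree that does not read [i] on [x] answers alike on [x] and [flip_bit x i], so it is correct
    on exactly one of them. The two success probabilities thus sum to at most 1 plus the probability
    of reading [i], and to at least 4/3 by correctness. *)
Lemma rdtree_reads_sensitive_bit f (mu : {fsfun dtree I -> R with 0}) x i :
    is_rdtree mu -> rdtree_computes mu f -> f (flip_bit x i) != f x ->
  1 / 3 <= \sum_(t <- finsupp mu) mu t * (i \in queried t x)%:R.
Proof.
move=> [mu_ge0 mu_sum1] muf f_flip.
suff : \sum_(t <- finsupp mu | dtree_eval t x == f x) mu t
    + \sum_(t <- finsupp mu | dtree_eval t (flip_bit x i) == f (flip_bit x i))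
        mu t
    <= \sum_(t <- finsupp mu) mu t
       + \sum_(t <- finsupp mu) mu t * (i \in queried t x)%:R.
  by have := muf x; have := muf (flip_bit x i); rewrite mu_sum1; lra.
rewrite !(big_mkcond (fun t => _ == _)) -!big_split /=.
apply: ler_sum => t _; have := mu_ge0 t.
case: (boolP (i \in queried t x)) => iq.
  by rewrite mulr1n; do 2 case: ifP => _; lra.
have -> : dtree_eval t (flip_bit x i) = dtree_eval t x.
  apply/esym/dtree_eval_queried => j jq; rewrite ffunE.
  by case: eqVneq => // ji; rewrite -ji jq in iq.
rewrite mulr0n mulr0 addr0; move: f_flip.
by case: (dtree_eval t x); case: (f x); case: (f (flip_bit x i)) => //= _; lra.
Qed.

(** Summed over [S], the reading probabilities give the expected number of bits of [S] read on [x],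
    which the depth bounds. *)
Lemma sensitivity_le_rquery_complexity f x (S : {set I}) :
    {in S, forall i, f (flip_bit x i) != f x} ->
  (#|S| <= 3 * rquery_complexity R f)%N.
Proof.
move=> f_flip; rewrite /rquery_complexity.
case: ex_minnP => _ /asboolP[mu [mu_rd muf <-]] _.
have [mu_ge0 mu_sum1] := mu_rd.
suff : #|S|%:R * (1 / 3) <= (rdtree_depth mu)%:R :> R.
  by rewrite -(ler_nat R) natrM; lra.
have -> : #|S|%:R * (1 / 3) = \sum_(i in S) (1 / 3) :> R.
  by rewrite sumr_const mulr_natl.
apply: (@le_trans _ _ (\sum_(i in S)
    \sum_(t <- finsupp mu) mu t * (i \in queried t x)%:R)).
  apply: ler_sum => i iS.
  exact: rdtree_reads_sensitive_bit mu_rd muf (f_flip i iS).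
rewrite exchange_big /= -[leRHS]mul1r.
have -> : 1 * (rdtree_depth mu)%:R =
    \sum_(t <- finsupp mu) mu t * (rdtree_depth mu)%:R :> R.
  by rewrite -mulr_suml mu_sum1.
rewrite [leLHS]big_seq [leRHS]big_seq.
apply: ler_sum => t t_mu; rewrite -mulr_sumr ler_wpM2l //.
rewrite -natr_sum ler_nat.
apply: (@leq_trans (dtree_depth t)); last first.
  by rewrite /rdtree_depth; apply: leq_bigmax_seq.
apply: leq_trans (size_queried t x).
(* A tree may read a bit twice, so [queried t x] can have repetitions. *)
apply: leq_trans (card_size (queried t x)).
rewrite -sum1_card big_mkcond [leqRHS]big_mkcond; apply: leq_sum => i _.
by case: (i \in S); case: (i \in queried t x).
Qed.

End QueryComplexityBounds.

Lemma card_ord_interval (n i j : nat) : (j <= n)%N ->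
  #|[set a : 'I_n | (i <= a < j)%N]%SET| = (j - i)%N.
Proof.
move=> jn; rewrite -sum1_card (eq_bigl (fun a : 'I_n => (i <= a < j)%N)).
  rewrite -(big_mkord (fun a => (i <= a < j)%N) (fun=> 1%N)).
  rewrite -[RHS]muln1 -sum_nat_const_nat.
  by rewrite (big_nat_widenl i 0) // (big_nat_widen _ _ _ _ _ jn).
by move=> a; rewrite inE.
Qed.

(* [v_i], [w_i], [u_j] are the vertices [i], [k + i], [2k + j]. *)
Definition kingless (n k : nat) : {ffun 'I_n * 'I_n -> bool} :=
  [ffun p : 'I_n * 'I_n => [&& p.1 < k, k <= p.2 & p.2 != p.1 + 2 * k :> nat]
             || [&& k <= p.1, p.1 < 2 * k & p.1 == p.2 + k :> nat]]%N.

Section Kingless.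
Context {n k : nat} (k_gt1 : (1 < k)%N) (k_le : (3 * k <= n)%N).

Lemma exist_king_kingless : exist_king (kingless n k) = false.
Proof.
apply/negbTE/existsP => -[v]; apply/negP; rewrite negb_forall; apply/existsP.
have v_lt := ltn_ord v.
(* A vertex that [v] fails to reach: [u_i] for [v_i]; [v_1] for [w_0], which reaches no [v_j] but
   [v_0]; and [v_0] for all the others. The boolean [v == k] is read as 0 or 1, and [v_1] exists
   since [1 < k]. *)
have u_lt : ((if v < k then v + 2 * k else v == k :> nat) < n)%N.
  by case: ifP; lia.
exists (Ordinal u_lt); rewrite negb_imply -val_eqE /= !ffunE /=.
rewrite negb_or negb_exists; apply/and3P; split; first by case: ifP; lia.
  by case: ifP; lia.
by apply/forallP => w; rewrite !ffunE /=; case: ifP; lia.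
Qed.

(** The flip adds the edge from [a] to [b], where [b] is [u_i] for [i = b - 2 * k]. The king is then
    [v_i]: it reaches [v_j] through [w_j], [u_i] through [a], and every other vertex directly. *)
Lemma exist_king_flip_kingless :
  {in finset.setX [set a : 'I_n | (k <= a < 2 * k)%N]%SET
           [set b : 'I_n | (2 * k <= b < 3 * k)%N]%SET,
   forall p, exist_king (flip_bit (kingless n k) p)}.
Proof.
move=> [a b]; rewrite !inE /= => /andP[/andP[ka ak] /andP[kb bk]].
have v_lt : (b - 2 * k < n)%N by lia.
have flipE c d : flip_bit (kingless n k) (a, b) (c, d) =
    ((c == a) && (d == b)) (+) kingless n k (c, d).
  by rewrite [LHS]ffunE xpair_eqE; case: (_ && _).
apply/existsP; exists (Ordinal v_lt); apply/forallP => u; apply/implyP.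
have u_lt := ltn_ord u; rewrite -val_eqE /= => u_v.
have [u_ltk|u_gek] := ltnP u k.
  have w_lt : (u + k < n)%N by lia.
  apply/orP; right; apply/existsP; exists (Ordinal w_lt).
  by rewrite !flipE !ffunE -!val_eqE /=; lia.
have [->|u_b] := eqVneq u b.
  apply/orP; right; apply/existsP; exists a.
  by rewrite !flipE !ffunE -!val_eqE /=; lia.
apply/orP; left; rewrite flipE ffunE -!val_eqE /=.
by move: u_b; rewrite -val_eqE /=; lia.
Qed.

End Kingless.

Theorem theorem4p2 (R : realType) :
  (fun n : nat => (rquery_complexity R (@exist_king n))%:R : R)
    \is 'Theta_\oo (fun n : nat => n%:R ^+ 2 : R).
Proof.
(* For [n >= 6] the floor [k] of [n / 3] is at least 2 and at least [n / 4], so three times the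
   complexity is at least [k ^ 2 >= n ^ 2 / 16]. *)
apply/asboolP; exists (1 / 48, 1); first by apply/andP; split => /=; lra.
exists 6%N => // n /= n_ge6; rewrite !ger0_norm ?exprn_ge0 ?ler0n //.
split; last first.
  have := @rquery_complexity_le_card R _ (@exist_king n).
  by rewrite mul1r card_prod card_ord -natrX ler_nat mulnn.
set c := rquery_complexity _ _; pose k := (n %/ 3)%N.
have [k_gt1 k_le] : (1 < k)%N /\ (3 * k <= n)%N by rewrite /k; lia.
pose S := finset.setX [set a : 'I_n | (k <= a < 2 * k)%N]%SET
                      [set b : 'I_n | (2 * k <= b < 3 * k)%N]%SET.
have : (#|S| <= 3 * c)%N.
  apply: (@sensitivity_le_rquery_complexity R _ _ (kingless n k)) => p pS.
  by rewrite exist_king_kingless // exist_king_flip_kingless.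
rewrite cardsX !card_ord_interval //; last by lia.
rewrite /k => card_le.
have : (n ^ 2 <= 48 * c)%N by nia.
by rewrite -(ler_nat R) natrM natrX; lra.
Qed.
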